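(* Let $(X,d)$ be a nonempty metric space with finite distance set $D=d(X\times X)$, and suppose there exists $r\in D$ such that the threshold relation $R_r^X$ is connected over $X$ and separating over $X$. Suppose that $$(X,d)\cong A_1^{m_1}\times_\infty\cdots\times_\infty A_s^{m_s}$$ is a finite $\ell^\infty$-prime factorization, where $s\geq1$, the $\ell^\infty$-prime metric spaces $A_1,\dots,A_s$ are pairwise nonisometric, and $m_i\geq1$ for every $1\leq i\leq s$. Let $k\geq2$ be an integer. If some $m_i$ is not divisible by $k$, then $\mathbf{PowStr}_k(X)$ has no objects. If $k\mid m_i$ for every $i$, let $\sqrt[k]{X}$ denote a metric space representing the isometry class of $A_1^{m_1/k}\times_\infty\cdots\times_\infty A_s^{m_s/k}$. Then $\Delta_k(\sqrt[k]{X})\cong(X,d)$, and every metric space $Y$ with $(X,d)\cong\Delta_k(Y)$ satisfies $Y\cong\sqrt[k]{X}$.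
   Context: All metric spaces are nonempty and all isometries are bijective; $\cong$ means isometric. Finite products $\times_\infty$ and powers carry the max product metric $\max_jd_j(p_j,q_j)$; $\Delta_k(P)$ is $P^k$ with this metric. A metric space $X$ is $\ell^\infty$-prime if $|X|>1$ and every isometry $X\cong Y\times_\infty Z$ forces $|Y|=1$ or $|Z|=1$. For $r\geq0$, $R_r^X(x,y)\iff d(x,y)\leq r$. $R_r^X$ is connected over $X$ if for all distinct $x,y\in X$ there is a finite sequence $x=x_0,\dots,x_n=y$ with $R_r^X(x_i,x_{i+1})$ for all $0\le i<n$; it is separating over $X$ if for all distinct $x,y\in X$ there is $z\in X$ such that exactly one of $R_r^X(z,x)$, $R_r^X(z,y)$ holds. For an equivalence relation $E$ on $X$, $\bar d_E([x]_E,[y]_E):=\inf\{d(x',y'):x'Ex,\ y'Ey\}$. $\mathbf{PowStr}_k(X)$ is the discrete category of ordered $k$-power structures on $(X,d)$: tuples $(E_1,\dots,E_k,\tau_2,\dots,\tau_k)$ with $E_j$ equivalence relations on $X$ and $\tau_j:X/E_j\to X/E_1$ maps such that each $\bar d_{E_j}$ is a metric on $X/E_j$; for all classes $C_j\in X/E_j$ ($1\le j\le k$), $\bigcap_{j=1}^kC_j$ is exactly one point; $d(x,y)=\max_{1\le j\le k}\bar d_{E_j}([x]_{E_j},[y]_{E_j})$ for all $x,y$; and each $\tau_j:(X/E_j,\bar d_{E_j})\to(X/E_1,\bar d_{E_1})$ is an isometry. *)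

(* Defs.v *)
From HB Require Import structures.
From mathcomp Require Import all_boot all_order all_algebra.
From mathcomp Require Import generic_quotient.
From mathcomp Require Import all_classical all_reals all_analysis.

Set Implicit Arguments.
Unset Strict Implicit.
Unset Printing Implicit Defensive.

Import Order.TTheory GRing.Theory Num.Theory.
Import numFieldNormedType.Exports.

Local Open Scope classical_set_scope.
Local Open Scope ring_scope.
Local Open Scope quotient_scope.

(* The library gives Y * Z the pseudometric whose balls are products of balls;
   the corresponding distance is the max distance. *)
Section prod_metric.
Context {R : realType} (Y Z : metricType R).
Implicit Types p q : (Y * Z)%type.

Definition prod_mdist p q : R :=
  Num.max (mdist p.1 q.1) (mdist p.2 q.2).

Let prod_mdist_ge0 p q : 0 <= prod_mdist p q.
Proof. by rewrite le_max mdist_ge0. Qed.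

Let prod_mdist_positivity p q : prod_mdist p q = 0 -> p = q.
Proof.
case: p q => [p1 p2] [q1 q2] /eqP; rewrite eq_le => /andP[+ _].
rewrite ge_max /= => /andP[d1 d2].
by congr pair; apply: mdist_positivity; apply/eqP; rewrite eq_le mdist_ge0 andbT.
Qed.

Let prod_ballE p (e : R) : ball p e = [set q | prod_mdist p q < e].
Proof.
rewrite predeqE => q /=; rewrite /prod_mdist gt_max.
split=> [[]|/andP[d1 d2]]; last by split; rewrite ballEmdist.
by rewrite !ballEmdist /= => -> ->.
Qed.

HB.instance Definition _ := PseudoMetric_isMetric.Build R (Y * Z)%type
  prod_mdist_ge0 prod_mdist_positivity prod_ballE.

End prod_metric.

Definition linf_prod (R : realType) (I : finType) (A : I -> metricType R) : Type :=
  {dffun forall i, A i}.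

Section linf_prod_metric.
Context {R : realType} (I : finType) (A : I -> metricType R).

HB.instance Definition _ := Choice.copy (linf_prod A) {dffun forall i, A i}.

Implicit Types p q : linf_prod A.

Definition linf_mdist p q : R := \big[Num.max/0]_(i : I) mdist (p i) (q i).

Let linf_mdistP p q (e : R) : 0 <= e ->
  (linf_mdist p q <= e) <-> (forall i, mdist (p i) (q i) <= e).
Proof.
move=> e0; split=> [+ i|h].
  by apply: le_trans; rewrite /linf_mdist (bigD1 i) //= le_max lexx.
by rewrite /linf_mdist; elim/big_ind: _ => // x y xe ye; rewrite ge_max xe.
Qed.

Let linf_mdist_ge0 p q : 0 <= linf_mdist p q.
Proof.
rewrite /linf_mdist; elim/big_ind: _ => [|x y x0 _|i _] //.
  by rewrite le_max x0.
exact: mdist_ge0.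
Qed.

Let linf_mdistxx p : linf_mdist p p = 0.
Proof.
apply/eqP; rewrite eq_le linf_mdist_ge0 andbT.
by apply/linf_mdistP => // i; rewrite mdistxx.
Qed.

Let linf_mdist_positivity p q : linf_mdist p q = 0 -> p = q.
Proof.
move=> pq0; apply/ffunP => i; apply: mdist_positivity.
apply/eqP; rewrite eq_le mdist_ge0 andbT.
by move: i; apply/linf_mdistP => //; rewrite pq0.
Qed.

Let linf_mdist_sym p q : linf_mdist p q = linf_mdist q p.
Proof. by apply: eq_bigr => i _; rewrite metric_sym. Qed.

Let linf_mdist_triangle q p t :
  linf_mdist p t <= linf_mdist p q + linf_mdist q t.
Proof.
apply/linf_mdistP => [|i]; first by rewrite addr_ge0.
apply: le_trans (metric_triangle _ (q i) _) _.
by apply: lerD; move: i; apply/linf_mdistP.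
Qed.

HB.instance Definition _ := isMetric.Build R (linf_prod A)
  linf_mdistxx linf_mdist_positivity linf_mdist_sym linf_mdist_triangle.

End linf_prod_metric.

Definition linf_power (R : realType) (k : nat) (P : metricType R) :
  metricType R := linf_prod (fun _ : 'I_k => P).

Section defs.
Context {R : realType}.

Definition is_isometry (T U : Type) (dT : T -> T -> R) (dU : U -> U -> R)
    (f : T -> U) : Prop :=
  bijective f /\ forall x y, dU (f x) (f y) = dT x y.

Definition isometric (X Y : metricType R) : Prop :=
  exists f : X -> Y, is_isometry mdist mdist f.

Definition singleton (X : Type) : Prop := exists x : X, [set: X] = [set x].

Definition linf_prime (X : metricType R) : Prop :=
  (exists x y : X, x <> y) /\
  forall Y Z : metricType R, [set: Y] !=set0 -> [set: Z] !=set0 ->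
    isometric X (Y * Z)%type -> singleton Y \/ singleton Z.

Definition distance_set (X : metricType R) : set R :=
  [set mdist x y | x in [set: X] & y in [set: X]].

Definition threshold (X : metricType R) (r : R) : rel X :=
  fun x y => mdist x y <= r.

Definition rel_connected (X : eqType) (Q : rel X) : Prop :=
  forall x y : X, x <> y -> exists p : seq X, path Q x p /\ last x p = y.

Definition rel_separating (X : eqType) (Q : rel X) : Prop :=
  forall x y : X, x <> y -> exists z : X, Q z x (+) Q z y.

Definition is_metric (T : Type) (d : T -> T -> R) : Prop :=
  [/\ forall x y, 0 <= d x y,
      forall x y, d x y = 0 <-> x = y,
      forall x y, d x y = d y x
    & forall x y z, d x z <= d x y + d y z].

Definition quot_dist (X : metricType R) (E : equiv_rel X)
    (C C' : {eq_quot E}) : R :=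
  inf [set mdist x y | x in [set x : X | \pi_{eq_quot E} x = C]
                     & y in [set y : X | \pi_{eq_quot E} y = C']].

Definition first_ord (k : nat) (k_gt1 : (1 < k)%N) : 'I_k :=
  Ordinal (ltnW k_gt1).

(* The objects of the discrete category of ordered k-power structures on X.
   Indices are shifted to 0, ..., k - 1, so that E_1 is the relation indexed by
   [first_ord k_gt1], and [ps_tau j] is given only for j other than that. *)
Record PowStr (k : nat) (k_gt1 : (1 < k)%N) (X : metricType R) := {
  ps_rel : 'I_k -> equiv_rel X ;
  ps_tau : forall j : 'I_k, j != first_ord k_gt1 ->
    {eq_quot (ps_rel j)} -> {eq_quot (ps_rel (first_ord k_gt1))} ;
  ps_metric : forall j, is_metric (@quot_dist X (ps_rel j)) ;
  ps_inter : forall C : (forall j, {eq_quot (ps_rel j)}),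
    exists x : X,
      \bigcap_j [set y : X | \pi_{eq_quot (ps_rel j)} y = C j] = [set x] ;
  ps_dist : forall x y : X, mdist x y =
    \big[Num.max/0]_(j < k) quot_dist (\pi_{eq_quot (ps_rel j)} x)
                                      (\pi_{eq_quot (ps_rel j)} y) ;
  ps_isometry : forall (j : 'I_k) (hj : j != first_ord k_gt1),
    is_isometry (@quot_dist X (ps_rel j))
      (@quot_dist X (ps_rel (first_ord k_gt1))) (ps_tau hj)
}.

End defs.

(* Main.v *)
Require Import Defs.
From HB Require Import structures.
From mathcomp Require Import all_boot all_order all_algebra.
From mathcomp Require Import perm generic_quotient.
From mathcomp Require Import all_classical all_reals all_analysis.

(** A decomposition X = Y x Z is recorded by one operation on X: f x y is the
    point with the Y-coordinate of x and the Z-coordinate of y. In a max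
    product, two points are at distance at most r exactly when both pairs of
    coordinates are, so f splits every threshold relation of X as a product of
    two relations.

    Everything rests on a refinement property, due to McKenzie for connected
    reflexive relations that separate points: if some threshold relation Q is
    connected and separating, then for any two decompositions f and g the set of
    points sharing a given Z-coordinate of f is closed under g
    ([splitting_class_closed]). It is first proved for the pair of points
    f (g x y) y and g (f x y) y with x and y adjacent. Order points by the trace
    of their Q-neighbourhood on the neighbourhood of y; each of the two points is
    a join of f x y and g x y in this preorder. Order them by the trace on the
    neighbourhood of x; each is a meet of f x y and g x y. These two facts force
    the two neighbourhoods to coincide ([neighbours_op]), and Q separates points,
    so the two points are equal ([local_commute]). Paths of Q propagate this
    to the whole space.

    For a base point x0 and a factor with index i, the fibre of i is the set of
    points agreeing with x0 in all coordinates other than i; it is a copy of the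
    factor. By refinement, a second decomposition g splits the fibre of a prime
    factor as a product, and primality makes one of the two sides trivial
    ([prime_fibre_split]). So in another factorization of X every prime fibre
    lies in one fibre ([prime_fibre_sub]), and each fibre of the other
    factorization is the product of the prime fibres that it contains
    ([fibre_block], [block_isometric]).

    Let now X be isometric to the k-th power of Y, and let x0 lie on the
    diagonal. A permutation of the k coordinates is an isometry of X fixing x0.
    It maps prime fibres to fibres of a prime factorization, hence permutes
    prime fibres ([prime_fibre_eq]) while preserving their isometry types. So
    each of the k fibres isometric to Y contains equally many prime fibres of
    type A_t. This number n_t satisfies m_t = k n_t, and Y is isometric to the
    product of the powers of A_t with exponents n_t ([root_factorization]). An
    ordered k-power structure on X exhibits X as the k-th power of the quotient
    X / E_1 ([PowStr_power]), which settles the case where k does not divide some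
    exponent. *)

Set Implicit Arguments.
Unset Strict Implicit.
Unset Printing Implicit Defensive.

Import Order.TTheory GRing.Theory Num.Theory.

Local Open Scope classical_set_scope.
Local Open Scope ring_scope.

(** * Decompositions of a relation *)

Definition flip_op {T : Type} (f : T -> T -> T) : T -> T -> T :=
  fun x y => f y x.

(** The first three laws make f a rectangular band, which is how the operation
    mixing the coordinates of two points of a product is described without
    naming the factors; the last one says that Q is the product relation. *)
Definition splitting {T : Type} (Q : rel T) (f : T -> T -> T) : Prop :=
  [/\ forall x, f x x = x,
      forall x y z, f (f x y) z = f x z,
      forall x y z, f x (f y z) = f x z
    & forall x y z, Q x y = Q (f x z) (f y z) && Q (f z x) (f z y)].

(** The points x and f y x differ only in the first coordinate, so this is
    relatedness of the first coordinates of x and y. *)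
Definition lrel {T : Type} (Q : rel T) (f : T -> T -> T) : rel T :=
  fun x y => Q x (f y x).

Definition rrel {T : Type} (Q : rel T) (f : T -> T -> T) : rel T :=
  lrel Q (flip_op f).

(** For fixed y this is a preorder with greatest element y. It compares u and v as
    seen from y, and replaces the order of X that the argument would use in a
    partially ordered set. *)
Definition below {T : Type} (Q : rel T) (y u v : T) : Prop :=
  forall w, Q w y -> Q w u -> Q w v.

Lemma splitting_flip (T : Type) (Q : rel T) (f : T -> T -> T) :
  splitting Q f -> splitting Q (flip_op f).
Proof.
rewrite /flip_op => -[fxx fl fr fQ]; split=> *; rewrite ?fxx ?fl ?fr //.
by rewrite andbC -fQ.
Qed.

Section coordinates.
Variables (T : Type) (Q : rel T).
Hypothesis Qxx : reflexive Q.

Lemma lrelxx f x : splitting Q f -> lrel Q f x x.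
Proof. by case=> fxx _ _ _; rewrite /lrel fxx Qxx. Qed.

Lemma lrel_opl f a b c : splitting Q f -> lrel Q f (f a b) c = lrel Q f a c.
Proof.
case=> fxx fl fr fQ.
by rewrite /lrel fr (fQ (f a b) (f c b) a) !fl !fr fxx Qxx andbT.
Qed.

Lemma lrel_opr f a b c : splitting Q f -> lrel Q f c (f a b) = lrel Q f c a.
Proof. by case=> fxx fl fr fQ; rewrite /lrel fl. Qed.

Variable f : T -> T -> T.
Hypothesis fQ : splitting Q f.
Let fQ' := splitting_flip fQ.

Lemma rrelxx x : rrel Q f x x.
Proof. exact: lrelxx. Qed.

Lemma rrel_opl a b c : rrel Q f (f a b) c = rrel Q f b c.
Proof. exact: (lrel_opl b a c fQ'). Qed.

Lemma rrel_opr a b c : rrel Q f c (f a b) = rrel Q f c b.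
Proof. exact: (lrel_opr b a c fQ'). Qed.

Lemma splittingE x y : Q x y = lrel Q f x y && rrel Q f x y.
Proof. by case: fQ => fxx fl fr /(_ x y x); rewrite fxx. Qed.

Definition coordE := ((fun x => lrelxx x fQ), rrelxx,
  (fun a b c => lrel_opl a b c fQ), (fun a b c => lrel_opr a b c fQ),
  rrel_opl, rrel_opr).

(** An inclusion between products of sets is an inclusion of the factors as soon
    as the smaller product is nonempty; the point w0 provides this. *)
Lemma below_split y u v w0 : Q w0 y -> Q w0 u ->
  below Q y u v <-> below (lrel Q f) y u v /\ below (rrel Q f) y u v.
Proof.
rewrite !splittingE => /andP[ly ry] /andP[lu ru]; split=> [b|[bl br] w].
- split=> w wy wu.
    have := b (f w w0); rewrite !splittingE !coordE wy wu ry ru.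
    by case/(_ isT isT)/andP.
  have := b (f w0 w); rewrite !splittingE !coordE wy wu ly lu.
  by case/(_ isT isT)/andP.
- rewrite !splittingE => /andP[? ?] /andP[? ?].
  by rewrite (bl w) ?(br w).
Qed.

End coordinates.

(** * Refinement for connected separating relations *)

Section refinement.
Variables (T : eqType) (Q : rel T).
Hypotheses (Qxx : reflexive Q) (Qsym : symmetric Q).

Section local.
Variables (f g : T -> T -> T) (x y : T).
Hypotheses (fQ : splitting Q f) (gQ : splitting Q g) (xy : Q x y).

Let fE := coordE Qxx fQ.
Let gE := coordE Qxx gQ.
Let fS := splittingE fQ.
Let gS := splittingE gQ.
Let fB := below_split Qxx fQ.
Let gB := below_split Qxx gQ.

Lemma adjacent_op : [/\ Q x (f x y), Q x (g x y),
  Q x (f (g x y) y) & Q x (g (f x y) y)].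
Proof.
move: (xy) (xy); rewrite {1}fS {1}gS => /andP[fl fr] /andP[gl gr].
have xf : Q x (f x y) by rewrite fS !fE fr.
have xg : Q x (g x y) by rewrite gS !gE gr.
split=> //.
  by move: xg; rewrite !fS !fE fr => /andP[->].
by move: xf; rewrite !gS !gE gr => /andP[->].
Qed.

(** In the preorder below Q y the point y is a greatest element. So f x y and
    g x y dominate x, and the coordinates of f (g x y) y are the joins of the
    coordinates of f x y and g x y. *)
Lemma below_join : [/\ below Q y (f x y) (f (g x y) y),
  below Q y (g x y) (f (g x y) y)
  & forall w, below Q y (f x y) w -> below Q y (g x y) w ->
     below Q y (f (g x y) y) w].
Proof.
have [xp xq xa xb] := adjacent_op.
have xg : below Q y x (g x y).
  by apply/(gB _ xy (Qxx x)); split=> w; rewrite !gE.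
have [xgl _] := (fB _ xy (Qxx x)).1 xg.
split.
- by apply/(fB _ xy xp); split=> w; rewrite !fE //; exact: xgl.
- by apply/(fB _ xy xq); split=> w; rewrite !fE.
- move=> w /(fB _ xy xp)[_ pr] /(fB _ xy xq)[ql _].
  apply/(fB _ xy xa); split=> v; rewrite !fE; first exact: ql.
  by move=> vy _; apply: pr => //; rewrite !fE.
Qed.

(** Seen from x the order is reversed: x is the greatest element, y lies under
    g x y, and f (g x y) y becomes a meet. *)
Lemma below_meet : [/\ below Q x (f (g x y) y) (f x y),
  below Q x (f (g x y) y) (g x y)
  & forall w, Q x w -> below Q x w (f x y) -> below Q x w (g x y) ->
     below Q x w (f (g x y) y)].
Proof.
have [xp xq xa xb] := adjacent_op.
have yg : below Q x y (g x y).
  by apply/(gB _ (Qxx x) xy); split=> w; rewrite !gE.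
have [_ ygr] := (fB _ (Qxx x) xy).1 yg.
split.
- by apply/(fB _ (Qxx x) xa); split=> w; rewrite !fE.
- by apply/(fB _ (Qxx x) xa); split=> w; rewrite !fE //; exact: ygr.
- move=> w xw /(fB _ (Qxx x) xw)[_ pr] /(fB _ (Qxx x) xw)[ql _].
  apply/(fB _ (Qxx x) xw); split=> v; rewrite !fE; first exact: ql.
  by move=> vx vw; have := pr v vx vw; rewrite !fE.
Qed.

End local.

(** Joins and meets of a preorder are determined up to equivalence, so
    a = f (g x y) y and b = g (f x y) y have equal traces on the neighbourhoods
    of x and of y. To bound the neighbourhood of a from below by that of b, argue
    on g-coordinates. The second one of b is that of y, where the trace at y is
    the full neighbourhood. The first one is that of p = f x y, so p is compared
    with g a p: the f-coordinates of p are those of x and of y, so the traces at x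
    and at y again give the inclusion of the full neighbourhoods. *)
Lemma neighbours_op f g x y : splitting Q f -> splitting Q g -> Q x y ->
  forall w, Q w (g (f x y) y) -> Q w (f (g x y) y).
Proof.
move=> fQ gQ xy.
have [xp xq xa xb] := adjacent_op fQ gQ xy.
have [pa qa aw] := below_join fQ gQ xy.
have [qb pb bw] := below_join gQ fQ xy.
have [ap aq wa] := below_meet fQ gQ xy.
have [bq bp wb] := below_meet gQ fQ xy.
have yba := bw _ qa pa.
have xba := wa _ xb bp bq.
(* From here on a is any point whose traces at x and at y contain those of b. *)
move: (f (g x y) y) pa xa xba yba
  {qa aw ap aq wa qb pb bw bq bp wb xq} => a _ xa xba yba.
set p := f x y in xp xb xba yba *.
have fE := coordE Qxx fQ.
have gE := coordE Qxx gQ.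
have fS := splittingE fQ.
have gS := splittingE gQ.
have fB := below_split Qxx fQ.
have gB := below_split Qxx gQ.
have [yl yr] := (gB _ _ _ _ xy xb).1 yba.
have [xl _] := (gB _ _ _ _ (Qxx x) xb).1 xba.
have xh : below Q x p (g a p).
  apply/(gB _ _ _ _ (Qxx x) xp).
  by split=> v; rewrite !gE // => vx vp; apply: xl; rewrite ?gE.
have yh : below Q y p (g a p).
  apply/(gB _ _ _ _ xy xp).
  by split=> v; rewrite !gE // => vx vp; apply: yl; rewrite ?gE.
have [xhl _] := (fB _ _ _ _ (Qxx x) xp).1 xh.
have [_ yhr] := (fB _ _ _ _ xy xp).1 yh.
have ph w : Q w p -> Q w (g a p).
  rewrite fS {1 2}/p !fE => /andP[wx wy].
  by rewrite fS xhl ?yhr // /p !fE.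
move=> w; rewrite gS !gE => /andP[wp wy].
rewrite gS yr ?gE // andbT.
have := ph (g w p); rewrite gS !gE wp => /(_ isT).
by rewrite gS !gE => /andP[].
Qed.

Hypotheses (Q_connected : rel_connected Q) (Q_separating : rel_separating Q).

Lemma local_commute f g x y : splitting Q f -> splitting Q g ->
  Q x y -> f (g x y) y = g (f x y) y.
Proof.
move=> fQ gQ xy; apply/eqP/negP => /negP/eqP/Q_separating[z].
suff -> : Q z (f (g x y) y) = Q z (g (f x y) y) by rewrite addbb.
by apply/idP/idP; [apply: (neighbours_op gQ fQ) | apply: (neighbours_op fQ gQ)].
Qed.

Lemma connected_ind (P : T -> Prop) (y : T) :
  P y -> (forall u v, Q u v -> P u -> P v) -> forall x, P x.
Proof.
move=> Py Pstep x; have [->//|/eqP/nesym/Q_connected[p [pp <-]]] := eqVneq x y.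
elim: p y Py pp => //= z p IH y Py /andP[yz zp].
by apply: IH => //; apply: Pstep yz Py.
Qed.

(** In g-coordinates p = (u, v), p' = (u', v) and t has second coordinate v'. The
    square with corners (u, v), (u', v), (u, v'), (u', v') has adjacent diagonal
    corners. Local commutation along the diagonal from (u, v') to (u', v) for f,
    and in the opposite direction for its flip, transports equality of second f-coordinates from the edge
    p p' to the opposite edge. *)
Lemma transport_step f g p p' t : splitting Q f -> splitting Q g ->
  Q p p' -> Q p t -> g p' p = p' -> f p p' = p ->
  f (g p t) (g p' t) = g p t.
Proof.
move=> fQ gQ pp' pt gp fp.
have gE := coordE Qxx gQ.
have gS := splittingE gQ.
have [_ gl gr _] := gQ.
have gpp' : g p p' = p by case: gQ => gxx _ _ _; rewrite -gp gr gxx.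
have qp' : Q p' (g p t).
  rewrite -gp gS !gE; move: pt; rewrite gS => /andP[_ ->].
  by move: pp'; rewrite Qsym gS => /andP[->].
have := local_commute fQ gQ (etrans (Qsym _ _) qp').
rewrite gl gpp' fp => fqp.
have := local_commute (splitting_flip fQ) gQ qp'.
by rewrite /flip_op gr => ->; rewrite -(gl _ p') -fqp gr.
Qed.

Lemma transport f g p p' : splitting Q f -> splitting Q g ->
  Q p p' -> g p' p = p' -> f p p' = p ->
  forall t, f (g p t) (g p' t) = g p t.
Proof.
move=> fQ gQ pp' gp fp.
have gE := coordE Qxx gQ.
have gS := splittingE gQ.
have [gxx gl gr _] := gQ.
apply: (connected_ind (y := p)); first by rewrite gxx gp.
move=> u v uv fu.
have := @transport_step f g (g p u) (g p' u) (g p v) fQ gQ.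
rewrite !gl !gr; apply=> //; rewrite gS !gE.
  by move: pp'; rewrite gS => /andP[->].
by move: uv; rewrite gS => /andP[].
Qed.

(** The hypothesis says that w and y have the same second f-coordinate, so w may be
    written f w y; letting the argument w of f w y run along a path from y, each
    step is handled by local commutation and by transport along g to y. *)
Theorem splitting_class_closed f g w y : splitting Q f -> splitting Q g ->
  f w y = w -> f (g w y) y = g w y.
Proof.
move=> fQ gQ <-; move: w.
have fE := coordE Qxx fQ.
have gE := coordE Qxx gQ.
have fS := splittingE fQ.
have gS := splittingE gQ.
have [fxx fl fr _] := fQ.
have [gxx gl gr _] := gQ.
apply: (connected_ind (y := y)); first by rewrite !(fxx, gxx).
move=> u v uv IH.
have ww' : Q (f v y) (f u y).
  by move: uv; rewrite Qsym !fS !fE => /andP[->].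
have := local_commute fQ gQ ww'; rewrite !(fl, fr) => fg.
have := @transport f g (f u y) (g (f v y) (f u y)) fQ gQ.
rewrite gl => /(_ _ erefl _ y) tr.
have {}tr : f (g (f u y) y) (g (f v y) y) = g (f u y) y.
  rewrite -tr ?gl //.
    by move: ww'; rewrite Qsym !gS !gE => /andP[->].
  by rewrite -fg !(fl, fr).
have fy : f y (g (f u y) y) = y by rewrite -IH fr fxx.
have := congr1 (f (g (f v y) y)) fy; rewrite fr => <-.
by rewrite -tr fr fxx.
Qed.

End refinement.

(** * Isometries of max products *)

Section isometries.
Context {R : realType}.
Implicit Types X Y Z : metricType R.

(** Distances in products are handled through their upper bounds, since a maximum
    is bounded by r exactly when all its entries are. *)
Lemma eq_bounds (a b : R) : 0 <= a -> 0 <= b ->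
  (forall r, 0 <= r -> (a <= r <-> b <= r)) -> a = b.
Proof.
move=> a0 b0 ab; apply/eqP; rewrite eq_le.
by rewrite (ab b b0).2 // (ab a a0).1.
Qed.

Lemma linf_mdist_le (I : finType) (A : I -> metricType R) (p q : linf_prod A)
    (r : R) : 0 <= r ->
  (mdist p q <= r) <-> (forall i, mdist (p i) (q i) <= r).
Proof.
move=> r0; have -> : mdist p q = \big[Num.max/0]_(i : I) mdist (p i) (q i) by [].
split=> [+ i|h]; first by apply: le_trans; rewrite (bigD1 i) //= le_max lexx.
by elim/big_ind: _ => // x y xr yr; rewrite ge_max xr.
Qed.

Lemma isometry_surj X Y (f : X -> Y) :
  (forall x y, mdist (f x) (f y) = mdist x y) ->
  (forall y, exists x, f x = y) -> is_isometry mdist mdist f.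
Proof.
move=> fd fs; split=> //; have [g gK] := choice fs; exists g => // x.
by apply: mdist_positivity; rewrite -fd gK mdistxx.
Qed.

Lemma isometric_refl X : isometric X X.
Proof. by exists id; apply: isometry_surj => // y; exists y. Qed.

Lemma isometric_sym X Y : isometric X Y -> isometric Y X.
Proof.
move=> [f [[g fK gK] fd]]; exists g; apply: isometry_surj => [x y|x].
  by rewrite -fd !gK.
by exists (f x).
Qed.

Lemma isometric_trans Y X Z : isometric X Y -> isometric Y Z -> isometric X Z.
Proof.
move=> [f [fb fd]] [g [gb gd]]; exists (g \o f).
by split=> [|x y /=]; [exact: bij_comp | rewrite gd fd].
Qed.

(** The isometry is built from the product over J to the product over I, because in
    this direction no transport along h is needed to define it. *)
Lemma linf_prod_reindex (I J : finType) (A : I -> metricType R)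
    (B : J -> metricType R) (h : I -> J) : bijective h ->
  (forall i, isometric (A i) (B (h i))) ->
  isometric (linf_prod A) (linf_prod B).
Proof.
move=> hb AB; apply: isometric_sym.
have {AB} [psi psiP] : exists psi : forall i, B (h i) -> A i,
    forall i, is_isometry mdist mdist (psi i).
  exists (fun i => projT1 (cid (isometric_sym (AB i)))) => i.
  exact: projT2 (cid (isometric_sym (AB i))).
exists (fun q : linf_prod B => [ffun i => psi i (q (h i))] : linf_prod A).
apply: isometry_surj => [p q|p].
- apply: eq_bounds => [||r r0]; rewrite ?mdist_ge0 // !linf_mdist_le //.
  have [h' hK h'K] := hb; split=> pq i.
    by have := pq (h' i); rewrite !ffunE (psiP _).2 h'K.
  by rewrite !ffunE (psiP _).2.
- have qP j : exists b : B j, forall i (ji : j = h i),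
      psi i (eq_rect j B b (h i) ji) = p i.
    have [h' hK h'K] := hb; rewrite -(h'K j); move: (h' j) => i.
    have [[phi phiK psiK] _] := psiP i; exists (phi (p i)) => i' ii'.
    have ei := bij_inj hb ii'; move: ii'; case: _ / ei => ii'.
    by rewrite (eq_irrelevance ii' erefl) psiK.
  exists [ffun j => projT1 (cid (qP j))].
  apply/ffunP => i; rewrite !ffunE.
  exact: projT2 (cid (qP (h i))) i erefl.
Qed.

Lemma linf_prod_flatten (I : finType) (J : I -> finType)
    (A : forall i, J i -> metricType R) :
  isometric (linf_prod (fun i => linf_prod (A i)))
    (linf_prod (fun u : {i : I & J i} => A (tag u) (tagged u))).
Proof.
exists (fun p : linf_prod (fun i => linf_prod (A i)) =>
  [ffun u : {i : I & J i} => p (tag u) (tagged u)] :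
    linf_prod (fun u : {i : I & J i} => A (tag u) (tagged u))).
apply: isometry_surj => [p q|p].
- apply: eq_bounds => [||r r0]; rewrite ?mdist_ge0 // !linf_mdist_le //.
  split=> [pq i|pq [i j]].
    by apply/linf_mdist_le => // j; have := pq (Tagged J j); rewrite !ffunE.
  by rewrite !ffunE /=; have /linf_mdist_le := pq i; apply.
- exists [ffun i => [ffun j => p (Tagged J j)]].
  by apply/ffunP => -[i j]; rewrite !ffunE.
Qed.

(** An element is sent to the one with the same rank among those of its type. *)
Lemma card_fibres_bijective (S I J : finType) (ty : I -> S) (ty' : J -> S) :
  (forall t, #|[pred i | ty i == t]| = #|[pred j | ty' j == t]|) ->
  exists2 h : I -> J, bijective h & forall i, ty' (h i) = ty i.
Proof.
have inj (I' J' : finType) (u : I' -> S) (u' : J' -> S) :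
    (forall t, #|[pred i | u i == t]| = #|[pred j | u' j == t]|) ->
    exists2 h : I' -> J', injective h & forall i, u' (h i) = u i.
  move=> card_eq.
  have hP i : exists j, u' j = u i /\
      index j (enum [pred j | u' j == u i]) =
      index i (enum [pred i' | u i' == u i]).
    have iP : i \in enum [pred i' | u i' == u i] by rewrite mem_enum inE.
    have := iP; rewrite -index_mem -cardE card_eq cardE => lt.
    have [j0] : exists j0, j0 \in enum [pred j | u' j == u i].
      move: lt; case: (enum [pred j : J' | _]) => // j0 s _.
      by exists j0; rewrite inE eqxx.
    move=> _; exists (nth j0 (enum [pred j | u' j == u i])
      (index i (enum [pred i' | u i' == u i]))).
    rewrite index_uniq ?enum_uniq //; split=> //.
    by have := mem_nth j0 lt; rewrite mem_enum inE => /eqP.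
  have [h hE] := choice hP; exists h => [i i' ii'|i]; last by case: (hE i).
  have [ti ei] := hE i; have [ti' ei'] := hE i'.
  have tii : u i = u i' by rewrite -ti -ti' ii'.
  move: ei; rewrite ii' tii ei' => /esym.
  by apply: (index_inj i); rewrite mem_enum inE ?tii.
move=> card_eq; have [h h_inj hE] := inj _ _ _ _ card_eq; exists h => //.
have [h' h'_inj _] := inj _ _ _ _ (fun t => esym (card_eq t)).
exact: inj_card_bij h_inj (leq_card _ h'_inj).
Qed.

Lemma linf_prod_count (S I J : finType) (A : S -> metricType R)
    (ty : I -> S) (ty' : J -> S) :
  (forall t, #|[pred i | ty i == t]| = #|[pred j | ty' j == t]|) ->
  isometric (linf_prod (fun i => A (ty i))) (linf_prod (fun j => A (ty' j))).
Proof.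
move=> /card_fibres_bijective[h hb hE]; apply: (linf_prod_reindex hb) => i.
by rewrite hE; exact: isometric_refl.
Qed.

Lemma card_tagged_fibre (S : finType) (n : S -> nat) t :
  #|[pred u : {t : S & 'I_(n t)} | tag u == t]| = n t.
Proof.
have := sig_big_dep (op := addn) (pred1 t) (fun t _ => true)
  (fun (t' : S) (_ : 'I_(n t')) => 1%N).
rewrite big_pred1_eq sum1_card card_ord -sum1_card => ->.
by apply: eq_bigl => u; rewrite inE andbT.
Qed.

Lemma linf_prod_powers (S I : finType) (A : S -> metricType R)
    (ty : I -> S) (n : S -> nat) :
  (forall t, #|[pred i | ty i == t]| = n t) ->
  isometric (linf_prod (fun i => A (ty i)))
    (linf_prod (fun t => linf_power (n t) (A t))).
Proof.
move=> card_ty.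
have flat := linf_prod_flatten (J := fun t => 'I_(n t)) (fun t _ => A t).
apply: isometric_trans (isometric_sym flat).
apply: (linf_prod_count A (ty' := fun u : {t & 'I_(n t)} => tag u)) => t.
by rewrite card_ty card_tagged_fibre.
Qed.

End isometries.

(** * Subspaces *)

Definition metric_sub (R : realType) (X : metricType R) (P : set X) : Type :=
  {x : X | x \in P}.

Definition to_sub (R : realType) (X : metricType R) (P : set X) (x : X)
  (xP : x \in P) : metric_sub P := exist (fun x => x \in P) x xP.
Arguments to_sub {R X P x} xP /.

Section metric_sub_metric.
Context {R : realType} (X : metricType R) (P : set X).

HB.instance Definition _ := Choice.copy (metric_sub P) {x : X | x \in P}.

Implicit Types p q : metric_sub P.

Definition metric_sub_mdist p q : R := mdist (val p) (val q).

Let metric_sub_mdistxx p : metric_sub_mdist p p = 0.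
Proof. exact: mdistxx. Qed.

Let metric_sub_positivity p q : metric_sub_mdist p q = 0 -> p = q.
Proof. by move=> /mdist_positivity/val_inj. Qed.

Let metric_sub_sym p q : metric_sub_mdist p q = metric_sub_mdist q p.
Proof. exact: metric_sym. Qed.

Let metric_sub_triangle q p t :
  metric_sub_mdist p t <= metric_sub_mdist p q + metric_sub_mdist q t.
Proof. exact: metric_triangle. Qed.

HB.instance Definition _ := isMetric.Build R (metric_sub P)
  metric_sub_mdistxx metric_sub_positivity metric_sub_sym metric_sub_triangle.

End metric_sub_metric.

(** * Factorizations and their fibres *)

Section factorizations.
Context {R : realType} {X : metricType R}.

(** Splitting every threshold relation amounts to distances in X being maxima of
    the distances between the two coordinates. *)
Definition metric_splitting (g : X -> X -> X) : Prop :=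
  forall r : R, 0 <= r -> splitting (@threshold R X r) g.

Section one_factorization.
Variables (I : finType) (A : I -> metricType R) (e : X -> linf_prod A).
Hypothesis e_iso : is_isometry mdist mdist e.

(** An inverse of e is only known to exist, hence the choice of a point; the
    default x is never taken when e is surjective. *)
Definition upd (x : X) i (a : A i) : X :=
  xget x [set z | forall j, e z j = eqtype.dfwith (e x) a j].

Lemma coord_ext x y : (forall i, e x i = e y i) -> x = y.
Proof. by move=> xy; apply: (bij_inj e_iso.1); apply/ffunP. Qed.

Lemma coord_surj (p : forall i, A i) : exists x, forall i, e x i = p i.
Proof.
have [[e' _ e'K] _] := e_iso; exists (e' [ffun i => p i]) => i.
by rewrite e'K ffunE.
Qed.

Lemma updE x i (a : A i) j : e (upd x a) j = eqtype.dfwith (e x) a j.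
Proof.
rewrite /upd; case: xgetP => [y _ /= -> //|none].
by have [z zE] := coord_surj (eqtype.dfwith (e x) a); case: (none z).
Qed.

Lemma upd_in x i (a : A i) : e (upd x a) i = a.
Proof. by rewrite updE dfwith_in. Qed.

Lemma upd_out x i (a : A i) j : j != i -> e (upd x a) j = e x j.
Proof. by move=> ji; rewrite updE dfwith_out // eq_sym. Qed.

Lemma mdist_coord x y (r : R) : 0 <= r ->
  mdist x y <= r <-> forall i, mdist (e x i) (e y i) <= r.
Proof. by move=> r0; rewrite -e_iso.2; exact: linf_mdist_le. Qed.

Definition mix i (x y : X) : X := upd y (e x i).

Lemma mix_in i x y : e (mix i x y) i = e x i.
Proof. exact: upd_in. Qed.

Lemma mix_out i x y j : j != i -> e (mix i x y) j = e y j.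
Proof. exact: upd_out. Qed.

Lemma mixE i x y j : e (mix i x y) j = if j == i then e x j else e y j.
Proof. by have [->|ji] := eqVneq; [exact: mix_in | exact: mix_out]. Qed.

Lemma mix_splitting i : metric_splitting (mix i).
Proof.
move=> r r0; split=> [x|x y z|x y z|x y z].
- by apply: coord_ext => j; rewrite mixE if_same.
- by apply: coord_ext => j; rewrite !mixE; case: (j == i).
- by apply: coord_ext => j; rewrite !mixE; case: (j == i).
- apply/idP/andP => [/(mdist_coord _ _ r0)xy|[]].
    by split; apply/(mdist_coord _ _ r0) => j; rewrite !mixE;
      case: (j == i); rewrite ?mdistxx.
  move=> /(mdist_coord _ _ r0)xyz /(mdist_coord _ _ r0)zxy.
  apply/(mdist_coord _ _ r0) => j; have := xyz j; have := zxy j.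
  by rewrite !mixE; case: (j == i).
Qed.

Lemma mix_same i x y : mix i y x = x <-> e x i = e y i.
Proof.
split=> [<-|xy]; first by rewrite mix_in.
by apply: coord_ext => j; rewrite mixE; case: eqP => // ->.
Qed.

(** The copy through x0 of the factor with index i. *)
Definition fibre i (x0 : X) : set X :=
  [set x | forall j, j != i -> e x j = e x0 j].

Lemma mix_fibre i x x0 : mix i x x0 = x <-> fibre i x0 x.
Proof.
split=> [<- j ji|xx0]; first by rewrite mix_out.
apply: coord_ext => j; rewrite mixE; case: (eqVneq j i) => // ji.
by rewrite xx0.
Qed.

Lemma upd_fibre x0 i (a : A i) : fibre i x0 (upd x0 a).
Proof. by move=> j ji; rewrite upd_out. Qed.

Lemma fibre_upd i x0 x : fibre i x0 x -> upd x0 (e x i) = x.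
Proof. by move=> /mix_fibre. Qed.

Lemma fibre_mdist i x0 x y : fibre i x0 x -> fibre i x0 y ->
  mdist (e x i) (e y i) = mdist x y.
Proof.
move=> Fx Fy; apply: eq_bounds => [||r r0]; rewrite ?mdist_ge0 // mdist_coord //.
split=> [xy j|]; last exact.
by have [->//|ji] := eqVneq j i; rewrite Fx // Fy // mdistxx.
Qed.

Lemma fibre_disjoint i j x0 x : i != j -> fibre i x0 x -> fibre j x0 x -> x = x0.
Proof.
move=> ij Fi Fj; apply: coord_ext => l.
by have [->|li] := eqVneq l i; [exact: Fj | exact: Fi].
Qed.

Lemma fibre_nontrivial i x0 : linf_prime (A i) ->
  exists2 x, fibre i x0 x & x != x0.
Proof.
move=> [[a [b ab]] _].
have [c cP] : exists c, c <> e x0 i.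
  have [ax|] := EM (a = e x0 i); last by exists a.
  by exists b => bx; apply: ab; rewrite ax bx.
exists (upd x0 c); first exact: upd_fibre.
by apply/eqP => cx; apply: cP; rewrite -cx upd_in.
Qed.

End one_factorization.

(** * Prime fibres *)

Section threshold_refinement.
Variable r : R.
Hypotheses (r_ge0 : 0 <= r).
Hypotheses (Q_connected : rel_connected (@threshold R X r)).
Hypotheses (Q_separating : rel_separating (@threshold R X r)).

Let Qxx : reflexive (@threshold R X r).
Proof. by move=> x; rewrite /threshold mdistxx. Qed.

Let Qsym : symmetric (@threshold R X r).
Proof. by move=> x y; rewrite /threshold metric_sym. Qed.

(** The refinement property for the decomposition of X into the factor i and the
    product of the others. *)
Lemma coord_op (I : finType) (A : I -> metricType R) (e : X -> linf_prod A) g i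
    x y : is_isometry mdist mdist e -> metric_splitting g ->
  e x i = e y i -> e (g x y) i = e y i.
Proof.
move=> e_iso gM xy.
have fQ := splitting_flip (mix_splitting e_iso i r_ge0).
have /(mix_same e_iso) := xy => xyE.
have := splitting_class_closed Qxx Qsym Q_connected Q_separating fQ
  (gM _ r_ge0) xyE.
by move=> /(mix_same e_iso).
Qed.

Section prime_fibres.
Variables (I : finType) (A : I -> metricType R) (e : X -> linf_prod A).
Hypotheses (e_iso : is_isometry mdist mdist e).

(** The fibre F is closed under g, hence isometric to the product of its points
    with the second g-coordinate of x0 and its points with the first
    g-coordinate of x0. One of these two sets is reduced to x0. *)
Lemma prime_fibre_split i g x0 : linf_prime (A i) -> metric_splitting g ->
  (fibre e i x0 `<=` [set x | g x x0 = x]) \/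
  (fibre e i x0 `<=` [set x | g x0 x = x]).
Proof.
move=> [_ A_prime] gM; have [gxx gl gr gQ] := gM r r_ge0.
have Fg x y : fibre e i x0 x -> fibre e i x0 y -> fibre e i x0 (g x y).
  by move=> Fx Fy j ji; rewrite (coord_op e_iso gM) ?Fx ?Fy.
have Fx0 : fibre e i x0 x0 by [].
pose P := [set x | fibre e i x0 x /\ g x x0 = x].
pose S := [set x | fibre e i x0 x /\ g x0 x = x].
have inP (a : A i) : g (upd e x0 a) x0 \in P.
  by rewrite inE; split; [apply: Fg => //; exact: (upd_fibre e_iso) | rewrite gl].
have inS (a : A i) : g x0 (upd e x0 a) \in S.
  by rewrite inE; split; [apply: Fg => //; exact: (upd_fibre e_iso) | rewrite gr].
have Px0 : x0 \in P by rewrite inE; split.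
have Sx0 : x0 \in S by rewrite inE; split.
have AE : isometric (A i) (metric_sub P * metric_sub S)%type.
  exists (fun a => (to_sub (inP a), to_sub (inS a)) :
    (metric_sub P * metric_sub S)%type).
  apply: isometry_surj => [a b|[[p pP] [s sS]]].
  - apply: eq_bounds => [||t t0]; rewrite ?mdist_ge0 //.
    have -> : mdist a b = mdist (upd e x0 a) (upd e x0 b).
      rewrite -(fibre_mdist e_iso (i := i) (x0 := x0)) ?upd_in //;
        exact: (upd_fibre e_iso).
    have [_ _ _ /(_ (upd e x0 a) (upd e x0 b) x0)] := gM t t0.
    rewrite /threshold => ->.
    have -> : forall u v : (metric_sub P * metric_sub S)%type, mdist u v =
      Num.max (mdist (val u.1) (val v.1)) (mdist (val u.2) (val v.2)) by [].
    by rewrite ge_max.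
  - have [Fp pE] : P p by move: pP; rewrite inE.
    have [Fs sE] : S s by move: sS; rewrite inE.
    exists (e (g p s) i); congr pair; apply: val_inj => /=;
      rewrite (fibre_upd e_iso) ?gl ?gr //; exact: Fg.
have [] := A_prime _ _ _ _ AE.
- by exists (to_sub Px0).
- by exists (to_sub Sx0).
- move=> [p pE]; right=> x Fx /=.
  have inP' : g x x0 \in P by rewrite inE; split; [exact: Fg | rewrite gl].
  have : [set: metric_sub P] (to_sub inP') by [].
  have : [set: metric_sub P] (to_sub Px0) by [].
  rewrite pE /= => <- /(congr1 val) /= xE.
  by rewrite -{1}xE gl gxx.
- move=> [p pE]; left=> x Fx /=.
  have inS' : g x0 x \in S by rewrite inE; split; [exact: Fg | rewrite gr].
  have : [set: metric_sub S] (to_sub inS') by [].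
  have : [set: metric_sub S] (to_sub Sx0) by [].
  rewrite pE /= => <- /(congr1 val) /= xE.
  by rewrite -{1}xE gr gxx.
Qed.

Variables (J : finType) (C : J -> metricType R) (e' : X -> linf_prod C).
Hypotheses (e'_iso : is_isometry mdist mdist e').

(** For each j, either the fibre is contained in the fibre of j or its coordinate j
    is constant; the coordinates cannot all be constant, as a prime space has two
    points. *)
Lemma prime_fibre_sub x0 i : linf_prime (A i) ->
  exists j, fibre e i x0 `<=` fibre e' j x0.
Proof.
move=> A_prime; apply: contrapT => noj.
have [x Fx /eqP] := fibre_nontrivial e_iso x0 A_prime; apply.
apply: (coord_ext e'_iso) => j.
have [xj|xj] := prime_fibre_split x0 A_prime (mix_splitting e'_iso j).
  by case: noj; exists j => y /xj /= /(mix_fibre e'_iso).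
by have /= /(mix_same e'_iso) := xj _ Fx.
Qed.

(** Refinement is used twice, with the roles of the two factorizations exchanged.
    For x in the fibre of j, moving x0 to coordinate i of x stays in that fibre
    and in the one of sigma i, hence does nothing when sigma i is not j.
    Conversely, if x differs from x0 only in coordinates of the block of j, then
    moving x0 to any other coordinate l of x changes no coordinate of e. *)
Lemma fibre_block (sigma : I -> J) x0 j x :
  (forall i, fibre e i x0 `<=` fibre e' (sigma i) x0) ->
  fibre e' j x0 x <-> forall i, sigma i != j -> e x i = e x0 i.
Proof.
move=> sigmaP.
have sub l y : fibre e' l x0 y -> forall i, sigma i != l -> e y i = e x0 i.
  move=> Gy i il; apply/esym/(mix_same e_iso).
  apply: (fibre_disjoint e'_iso il).
    by apply: sigmaP; apply: (upd_fibre e_iso).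
  move=> j' j'l.
  by rewrite (coord_op e'_iso (mix_splitting e_iso i)) // Gy.
split=> [/sub//|xE l lj]; apply/esym/(mix_same e'_iso).
apply: (coord_ext e_iso) => i.
have [il|il] := eqVneq (sigma i) l.
  rewrite (coord_op e_iso (mix_splitting e'_iso l)) //.
  by rewrite xE // il.
by apply: sub il; apply: (upd_fibre e'_iso).
Qed.

End prime_fibres.
End threshold_refinement.
End factorizations.

Section blocks.
Context {R : realType} {X : metricType R} (r : R).
Hypotheses (r_ge0 : 0 <= r).
Hypotheses (Q_connected : rel_connected (@threshold R X r)).
Hypotheses (Q_separating : rel_separating (@threshold R X r)).
Variables (I J : finType) (A : I -> metricType R) (C : J -> metricType R).
Variables (e : X -> linf_prod A) (e' : X -> linf_prod C).
Hypotheses (e_iso : is_isometry mdist mdist e).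
Hypotheses (e'_iso : is_isometry mdist mdist e').

Lemma fibre_isometric x0 i j : fibre e i x0 = fibre e' j x0 ->
  isometric (A i) (C j).
Proof.
move=> Fij; exists (fun a => e' (upd e x0 a) j).
have Fi (a : A i) : fibre e i x0 (upd e x0 a) by apply: (upd_fibre e_iso).
apply: isometry_surj => [a b|c].
  rewrite (fibre_mdist e'_iso (x0 := x0)) -?Fij //.
  by rewrite -(fibre_mdist e_iso (Fi a) (Fi b)) !(upd_in e_iso).
have : fibre e' j x0 (upd e' x0 c) by apply: (upd_fibre e'_iso).
rewrite -Fij => /(fibre_upd e_iso) cE.
by exists (e (upd e' x0 c) i); rewrite cE (upd_in e'_iso).
Qed.

(** The inclusions of prime fibres in both directions compose to an inclusion
    of one e-fibre in another, and distinct fibres meet only in x0. *)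
Lemma prime_fibre_eq x0 i :
  (forall i, linf_prime (A i)) -> (forall j, linf_prime (C j)) ->
  exists j, fibre e i x0 = fibre e' j x0.
Proof.
move=> Ap Cp.
have [j ij] := prime_fibre_sub r_ge0 Q_connected Q_separating e_iso e'_iso
  x0 (Ap i).
have [i' ji'] := prime_fibre_sub r_ge0 Q_connected Q_separating e'_iso e_iso
  x0 (Cp j).
exists j; apply/seteqP; split=> // x /ji'.
suff -> : i' = i by [].
apply/eqP/negPn/negP => i'i.
have [y Fy /eqP] := fibre_nontrivial e_iso x0 (Ap i); apply.
exact: (fibre_disjoint e_iso i'i (ji' _ (ij _ Fy)) Fy).
Qed.

Lemma block_isometric (sigma : I -> J) x0 j :
  (forall i, fibre e i x0 `<=` fibre e' (sigma i) x0) ->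
  isometric (C j) (linf_prod (fun u : {i : I | sigma i == j} => A (val u))).
Proof.
move=> sigmaP.
have blockP := fun x => fibre_block r_ge0 Q_connected Q_separating e_iso e'_iso
  j x sigmaP.
have Fj (c : C j) : fibre e' j x0 (upd e' x0 c) by apply: (upd_fibre e'_iso).
exists (fun c => [ffun u => e (upd e' x0 c) (val u)] :
  linf_prod (fun u : {i : I | sigma i == j} => A (val u))).
apply: isometry_surj => [c d|p].
- have -> : mdist c d = mdist (upd e' x0 c) (upd e' x0 d).
    by rewrite -(fibre_mdist e'_iso (Fj c) (Fj d)) !(upd_in e'_iso).
  apply: eq_bounds => [||t t0]; rewrite ?mdist_ge0 //.
  rewrite linf_mdist_le // (mdist_coord e_iso) //.
  split=> [cd i|cd u]; last by rewrite !ffunE.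
  have [ij|ij] := boolP (sigma i == j); last first.
    have [/blockP xc /blockP xd] := (Fj c, Fj d).
    by rewrite xc // xd // mdistxx.
  by have := cd (Sub i ij); rewrite !ffunE.
- have [x xE] := coord_surj e_iso (fun i => match pselect (sigma i == j) with
    | left ij => p (Sub i ij) | right _ => e x0 i end).
  have /blockP/(fibre_upd e'_iso) Fx : forall i, sigma i != j -> e x i = e x0 i.
    by move=> i ij; rewrite xE; case: pselect => // ij'; rewrite ij' in ij.
  exists (e' x j); apply/ffunP => -[i ij]; rewrite ffunE Fx /= xE.
  by case: pselect => // ij'; rewrite (bool_irrelevance ij' ij).
Qed.

End blocks.

(** * Roots *)

Section root.
Context {R : realType} {X : metricType R} (r : R).
Hypotheses (r_ge0 : 0 <= r).
Hypotheses (Q_connected : rel_connected (@threshold R X r)).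
Hypotheses (Q_separating : rel_separating (@threshold R X r)).
Variables (S I : finType) (A : S -> metricType R) (ty : I -> S).
Hypothesis A_prime : forall t, linf_prime (A t).
Hypothesis A_nonisometric : forall t t', t <> t' -> ~ isometric (A t) (A t').
Variables (k : nat) (Y : metricType R) (j0 : 'I_k).
Variable e : X -> linf_prod (fun i => A (ty i)).
Hypotheses (e_iso : is_isometry mdist mdist e).

Lemma power_permute (e' : X -> linf_power k Y) (s : {perm 'I_k}) :
  is_isometry mdist mdist e' ->
  exists2 phi : X -> X, is_isometry mdist mdist phi
    & forall x j, e' (phi x) j = e' x (s j).
Proof.
move=> e'_iso.
have phiP x : exists z, forall j, e' z j = e' x (s j).
  exact: (coord_surj e'_iso (fun j => e' x (s j))).
have [phi phiE] := choice phiP; exists phi => //.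
apply: isometry_surj => [x y|y].
- apply: eq_bounds => [||t t0]; rewrite ?mdist_ge0 // !(mdist_coord e'_iso) //.
  split=> xy j; last by rewrite !phiE.
  by have := xy (s^-1%g j); rewrite !phiE permKV.
- have [x xE] := coord_surj e'_iso (fun j => e' y (s^-1%g j)).
  by exists x; apply: (coord_ext e'_iso) => j; rewrite phiE xE permK.
Qed.

(** The number n t counts the prime fibres of type t inside one fibre of the power;
    swapping that fibre with another shows that it is the same for all of them. *)
Lemma root_factorization : isometric X (linf_power k Y) -> [set: Y] !=set0 ->
  exists2 n : S -> nat, forall t, #|[pred i | ty i == t]| = (k * n t)%N
    & isometric Y (linf_prod (fun t => linf_power (n t) (A t))).
Proof.
move=> [e' e'_iso] [y0 _].
have [x0 x0E] := coord_surj e'_iso (fun=> y0).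
have Ap i : linf_prime (A (ty i)) by [].
have [sigma sigmaP] := choice (fun i =>
  prime_fibre_sub r_ge0 Q_connected Q_separating e_iso e'_iso x0 (Ap i)).
pose N j t := #|[pred i | (sigma i == j) && (ty i == t)]|.
have N_const j t : N j t = N j0 t.
  (* The transposition of j and j0 acts on X by an isometry phi fixing the
     diagonal point x0, and e \o phi is another prime factorization of X. *)
  have [phi [phi_bij phi_dist] phiE] := power_permute (tperm j j0) e'_iso.
  have phi0 : phi x0 = x0.
    by apply: (coord_ext e'_iso) => l; rewrite phiE !x0E.
  have ephi_iso : is_isometry mdist mdist (e \o phi).
    split=> [|x y /=]; last by rewrite e_iso.2 phi_dist.
    by apply: bij_comp => //; case: e_iso.
  have [rho rhoP] := choice (fun i => prime_fibre_eq r_ge0 Q_connected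
    Q_separating ephi_iso e_iso x0 i Ap Ap).
  have rho_ty i : ty (rho i) = ty i.
    apply: contrapT => /nesym/A_nonisometric; apply.
    exact: (fibre_isometric ephi_iso e_iso (rhoP i)).
  have rho_sigma i : sigma (rho i) = tperm j j0 (sigma i).
    have [y Fy /eqP yx0] := fibre_nontrivial e_iso x0 (Ap (rho i)).
    have Gy := sigmaP _ _ Fy.
    apply/eqP/negPn/negP => ne; apply: yx0.
    apply: (fibre_disjoint e'_iso ne Gy).
    have : fibre e i x0 (phi y).
      move: Fy; rewrite -rhoP => Fy i' i'i.
      by have := Fy i' i'i; rewrite /= phi0.
    move=> /sigmaP Gphi l ls.
    have := Gphi (tperm j j0 l); rewrite phiE tpermK !x0E; apply.
    by apply: contra ls => /eqP <-; rewrite tpermK.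
  have rho_inj : injective rho.
    move=> i i' ii'; apply/eqP/negPn/negP => ne.
    have [y Fy /eqP] := fibre_nontrivial ephi_iso x0 (Ap i); apply.
    by apply: (fibre_disjoint ephi_iso ne Fy); rewrite rhoP -ii' -rhoP.
  rewrite /N -!sum1_card (reindex rho) /=; last first.
    by apply: onW_bij; exact: injF_bij.
  apply: eq_bigl => i; rewrite !inE rho_ty rho_sigma.
  by rewrite (can2_eq (tpermK j j0) (tpermK j j0)) tpermL.
exists (N j0) => [t|].
  rewrite -sum1_card (partition_big sigma predT) //=.
  rewrite (eq_bigr (fun=> N j0 t)) => [|j _].
    by rewrite sum_nat_const card_ord.
  by rewrite sum1_card -(N_const j); apply: eq_card => i; rewrite !inE andbC.
apply: (isometric_trans (block_isometric r_ge0 Q_connected Q_separating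
  e_iso e'_iso j0 sigmaP)).
apply: (linf_prod_powers A (ty := fun u : {i | sigma i == j0} => ty (val u))) => t.
rewrite -(fintype.card_image val_inj) /N.
apply: eq_card => i; apply/fintype.imageP/andP => [[u]|[ij it]].
  by rewrite inE => ut ->; split=> //; case: u {ut}.
by exists (Sub i ij).
Qed.

End root.

(** A type carrying d as its distance, so that quotients by the relations of a power
    structure become metric spaces. *)
Definition metrized {R : realType} (T : choiceType) (d : T -> T -> R)
  (dP : is_metric d) : Type := T.

Section metrized_metric.
Context {R : realType} (T : choiceType) (d : T -> T -> R) (dP : is_metric d).

HB.instance Definition _ := Choice.copy (metrized dP) T.

Let metrizedxx (x : metrized dP) : d x x = 0.
Proof. by have [_ d0 _ _] := dP; apply/d0. Qed.

Let metrized_positivity (x y : metrized dP) : d x y = 0 -> x = y.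
Proof. by have [_ d0 _ _] := dP; move=> /d0. Qed.

Let metrized_sym (x y : metrized dP) : d x y = d y x.
Proof. by have [_ _ ds _] := dP; exact: ds. Qed.

Let metrized_triangle (y x z : metrized dP) : d x z <= d x y + d y z.
Proof. by have [_ _ _ dt] := dP; exact: dt. Qed.

HB.instance Definition _ := isMetric.Build R (metrized dP)
  metrizedxx metrized_positivity metrized_sym metrized_triangle.

End metrized_metric.

(** The classes of a point, moved to X / E_1 by the isometries tau_j and the
    identity for j = 1, are its k coordinates. *)
Lemma PowStr_power (R : realType) (k : nat) (k_gt1 : (1 < k)%N)
    (X : metricType R) : PowStr k_gt1 X ->
  exists Y : metricType R, isometric X (linf_power k Y).
Proof.
move=> [E tau E_metric E_inter E_dist tau_iso].
pose j0 := first_ord k_gt1.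
pose Y : metricType R := metrized (E_metric j0).
have [theta thetaP] : exists theta : forall j, {eq_quot (E j)}%qT -> Y,
    forall j, is_isometry (@quot_dist R X (E j)) mdist (theta j).
  have thetaP j : exists theta : {eq_quot (E j)}%qT -> Y,
      is_isometry (@quot_dist R X (E j)) mdist theta.
    have [->|jj0] := eqVneq j j0; last by exists (tau j jj0); exact: tau_iso.
    by exists id; split=> //; exists id.
  exists (fun j => projT1 (cid (thetaP j))) => j.
  exact: projT2 (cid (thetaP j)).
exists Y, (fun x => [ffun j => theta j (\pi_{eq_quot (E j)} x)%qT] :
  linf_power k Y).
apply: isometry_surj => [x y|p].
- rewrite E_dist; apply: eq_bigr => j _.
  by rewrite !ffunE (thetaP j).2.
- have invP j : exists c : {eq_quot (E j)}%qT, theta j c = p j.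
    by have [[g _ gK] _] := thetaP j; exists (g (p j)); rewrite gK.
  have [x xE] := E_inter (fun j => projT1 (cid (invP j))).
  exists x; apply/ffunP => j; rewrite ffunE -(projT2 (cid (invP j))).
  by congr (theta j _); have : [set x] x by []; rewrite -xE; apply.
Qed.

Theorem theorem4p66 (R : realType) (X : metricType R)
    (X_nonempty : [set: X] !=set0)
    (D_finite : finite_set (distance_set X))
    (D_threshold : exists r : R, [/\ distance_set X r,
       rel_connected (@threshold R X r) & rel_separating (@threshold R X r)])
    (s : nat) (s_gt0 : (0 < s)%N) (A : 'I_s -> metricType R) (m : 'I_s -> nat)
    (A_prime : forall i, linf_prime (A i))
    (A_nonisometric : forall i j, i <> j -> ~ isometric (A i) (A j))
    (m_gt0 : forall i, (0 < m i)%N)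
    (X_fact : isometric X (linf_prod (fun i => linf_power (m i) (A i))))
    (k : nat) (k_gt1 : (1 < k)%N) :
  ((exists i, ~~ (k %| m i)%N) -> ~ inhabited (PowStr k_gt1 X)) /\
  ((forall i, (k %| m i)%N) ->
   forall rootX : metricType R,
     isometric rootX (linf_prod (fun i => linf_power (m i %/ k)%N (A i))) ->
     isometric (linf_power k rootX) X /\
     forall Y : metricType R, [set: Y] !=set0 ->
       isometric X (linf_power k Y) -> isometric Y rootX).
Proof.
have [r [[x _ [y _ rE]] Q_connected Q_separating]] := D_threshold.
have r_ge0 : 0 <= r by rewrite -rE mdist_ge0.
have [e e_iso] := isometric_trans X_fact
  (linf_prod_flatten (J := fun t => 'I_(m t)) (fun t _ => A t)).
have root (Y : metricType R) : [set: Y] !=set0 -> isometric X (linf_power k Y) ->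
    exists2 n, forall t, m t = (k * n t)%N
      & isometric Y (linf_prod (fun t => linf_power (n t) (A t))).
  move=> Y0 XY.
  have [n nE YE] := root_factorization r_ge0 Q_connected Q_separating A_prime
    A_nonisometric (first_ord k_gt1) e_iso XY Y0.
  by exists n => // t; rewrite -nE card_tagged_fibre.
split=> [[t ktm] [PX]|km rootX rootE].
  have [Y XY] := PowStr_power PX.
  have Y0 : [set: Y] !=set0.
    by have [f _] := XY; exists (f x (first_ord k_gt1)).
  have [n nE _] := root Y Y0 XY.
  by move: ktm; rewrite nE dvdn_mulr.
split=> [|Y Y0 XY]; last first.
  have [n nE YE] := root Y Y0 XY.
  apply: (isometric_trans YE); apply: isometric_trans (isometric_sym rootE).
  suff -> : n = (fun i => m i %/ k)%N by exact: isometric_refl.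
  by apply/funext => t; rewrite nE mulKn // ltnW.
apply: isometric_trans (isometric_sym X_fact).
have id_bij : bijective (@id 'I_k) by exists id.
apply: (isometric_trans (linf_prod_reindex id_bij (fun=> rootE))).
apply: (isometric_trans (linf_prod_reindex id_bij (fun=>
  linf_prod_flatten (J := fun t => 'I_(m t %/ k)) (fun t _ => A t)))).
pose J := {t : 'I_s & 'I_(m t %/ k)}.
apply: (isometric_trans (linf_prod_flatten (J := fun _ : 'I_k => J)
  (fun _ u => A (tag u)))).
apply: (linf_prod_powers A (ty := fun u : {_ : 'I_k & J} =>
  tag (tagged u))) => t.
rewrite -sum1_card -(sig_big_dep (op := addn) predT (fun _ (u : J) => tag u == t)
  (fun _ _ => 1%N)) /=.
rewrite (eq_bigr (fun=> m t %/ k)%N) => [|j _].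
  by rewrite sum_nat_const card_ord mulnC divnK.
by rewrite sum1_card card_tagged_fibre.
Qed.
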